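(* Let $\mathbb{F}$ be a finite field with $q$ elements, $r_1,\dots,r_s$ positive integers, $n=r_1\cdots r_s$ with $\gcd(n,q)=1$, and let $\boldsymbol{\alpha}\in U$ be fixed. Then there is a bijective correspondence between the abelian codes (ideals) of $\mathbb{F}(r_1,\dots,r_s)$ and the elements of $\mathcal{Q}$, given by the mutually inverse maps $$C\longmapsto \mathcal{D}_{\boldsymbol{\alpha}}(C),\qquad Q\longmapsto \{f\in \mathbb{F}(r_1,\dots,r_s)\mid f(\boldsymbol{\alpha}^m)=0\ \text{for all } m\in Q\},$$ for any code $C$ in $\mathbb{F}(r_1,\dots,r_s)$ and any $Q\in\mathcal{Q}$.
   Context: $\mathbb{F}(r_1,\dots,r_s)=\mathbb{F}[X_1,\dots,X_s]/\langle X_1^{r_1}-1,\dots,X_s^{r_s}-1\rangle$; it is semisimple since $\gcd(n,q)=1$. An abelian code (or code) is an ideal of this algebra. Put $\mathcal{I}=\mathbb{Z}_{r_1}\times\cdots\times\mathbb{Z}_{r_s}$, elements being written by canonical representatives. $\mathbb{L}$ is an extension field of $\mathbb{F}$ containing, for every $i$, the primitive $r_i$-th roots of unity; $U=\prod_{i=1}^s U_{r_i}$, where $U_{r_i}\subseteq \mathbb{L}$ is the set of primitive $r_i$-th roots of unity. For $\boldsymbol{\alpha}=(\alpha_1,\dots,\alpha_s)\in U$ and $m=(m_1,\dots,m_s)\in\mathcal{I}$, $\boldsymbol{\alpha}^m=(\alpha_1^{m_1},\dots,\alpha_s^{m_s})$. For $f\in\mathbb{F}(r_1,\dots,r_s)$,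 $f(\boldsymbol{\alpha}^m)$ is the value at $\boldsymbol{\alpha}^m$ of the canonical representative of $f$ (or of any representative). The $q$-orbit of $(a_1,\dots,a_s)\in\mathcal{I}$ is $Q(a_1,\dots,a_s)=\{(a_1q^i,\dots,a_sq^i)\mid i\in\mathbb{N}\}\subseteq\mathcal{I}$. $\mathcal{Q}$ is the collection of all subsets of $\mathcal{I}$ that are unions of $q$-orbits (including the empty union). The defining set of a subset $A\subseteq \mathbb{F}(r_1,\dots,r_s)$ with respect to $\boldsymbol{\alpha}$ is $\mathcal{D}_{\boldsymbol{\alpha}}(A)=\{m\in\mathcal{I}\mid f(\boldsymbol{\alpha}^m)=0\ \text{for all } f\in A\}$. *)

(* Defs.v *)
From HB Require Import structures.
From mathcomp Require Import all_boot all_algebra.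
From mathcomp Require Import boolp classical_sets functions.
From mathcomp Require Import mpoly.

Set Implicit Arguments.
Unset Strict Implicit.
Unset Printing Implicit Defensive.

Import GRing.Theory.
Local Open Scope ring_scope.
Local Open Scope classical_set_scope.
Local Open Scope quotient_scope.

Section Algebra.
Variables (F : fieldType) (s : nat) (r : 'I_s -> nat).

Definition cyclic_relations : {pred {mpoly F[s]}} := fun p =>
  `[< exists g : 'I_s -> {mpoly F[s]}, p = \sum_i g i * ('X_i ^+ r i - 1) >].

Lemma cyclic_relations_eval (S : comNzRingType) (f : {rmorphism F -> S})
    (x : 'I_s -> S) (p : {mpoly F[s]}) :
  (forall i, x i ^+ r i = 1) -> p \in cyclic_relations ->
  (map_mpoly f p).@[x] = 0.
Proof.
move=> x1 /asboolP [g ->].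
have -> q : (map_mpoly f q).@[x] = (meval x \o map_mpoly f) q by [].
rewrite rmorph_sum big1 // => i _.
rewrite rmorphM rmorphB rmorphXn rmorph1 /= map_mpolyX mevalXU x1.
by rewrite subrr mulr0.
Qed.

Lemma cyclic_relations_idealr : idealr_closed cyclic_relations.
Proof.
split.
- by apply/asboolP; exists (fun=> 0); rewrite big1 // => i _; rewrite mul0r.
- apply/negP => /(cyclic_relations_eval (idfun : {rmorphism F -> F}) (x := fun=> 1)).
  move=> /(_ (fun i => expr1n _ _)); rewrite rmorph1 meval1 => /eqP.
  by rewrite oner_eq0.
- move=> a u v /asboolP [g ->] /asboolP [h ->]; apply/asboolP.
  exists (fun i => a * g i + h i).
  by rewrite mulr_sumr -big_split; apply: eq_bigr => i _; rewrite mulrDl mulrA.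
Qed.

HB.instance Definition _ :=
  isIdealr.Build {mpoly F[s]} cyclic_relations cyclic_relations_idealr.

Definition abelian_algebra := {ideal_quot cyclic_relations}.

End Algebra.

(* The improper ideal is allowed, unlike in [idealr]. *)
Definition is_ideal (A : comNzRingType) (C : set A) : Prop :=
  [/\ C 0, forall u v, C u -> C v -> C (u + v) & forall a u, C u -> C (a * u)].

Definition abelian_codes (F : fieldType) (s : nat) (r : 'I_s -> nat) :
  set (set (abelian_algebra F r)) := [set C | is_ideal C].

(* Z_{r_1} x ... x Z_{r_s} by canonical representatives; 'Z_(r i) would be wrong
   for r i = 1. *)
Definition index_grid (s : nat) (r : 'I_s -> nat) :=
  {dffun forall i : 'I_s, 'I_(r i)}.

Section Orbits.
Variables (s : nat) (r : 'I_s -> nat) (q : nat).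

Definition qorbit (a : index_grid r) : set (index_grid r) :=
  [set b : index_grid r | exists j : nat, forall i, b i = (a i * q ^ j) %% r i :> nat]%N.

Definition qorbit_unions : set (set (index_grid r)) :=
  [set Q | exists B : set (index_grid r), Q = \bigcup_(a in B) qorbit a].

End Orbits.

Section Evaluation.
Variables (F L : fieldType) (iota : {rmorphism F -> L}).
Variables (s : nat) (r : 'I_s -> nat).

Definition code_eval (f : abelian_algebra F r) (x : 'I_s -> L) : L :=
  (map_mpoly iota (repr f)).@[x].

(* [code_eval f x] is independent of the representative only at points x with
   x_i ^ r_i = 1, which covers all powers of alpha. *)
Lemma code_eval_pi (p : {mpoly F[s]}) (x : 'I_s -> L) :
  (forall i, x i ^+ r i = 1) ->
  code_eval (\pi_(abelian_algebra F r) p) x = (map_mpoly iota p).@[x].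
Proof.
move=> x1; apply/eqP; rewrite /code_eval -subr_eq0 -!rmorphB; apply/eqP.
apply: (cyclic_relations_eval iota x1).
by rewrite Quotient.idealrBE reprK.
Qed.

Variable alpha : 'I_s -> L.

Definition power_point (m : index_grid r) : 'I_s -> L := fun i => alpha i ^+ m i.

Lemma code_eval_power_point (p : {mpoly F[s]}) (m : index_grid r) :
  (forall i, (r i).-primitive_root (alpha i)) ->
  code_eval (\pi_(abelian_algebra F r) p) (power_point m)
  = (map_mpoly iota p).@[power_point m].
Proof.
move=> ha; apply: code_eval_pi => i.
by rewrite /power_point exprAC (prim_expr_order (ha i)) expr1n.
Qed.

Definition defining_set (A : set (abelian_algebra F r)) : set (index_grid r) :=
  [set m | forall f, A f -> code_eval f (power_point m) = 0].

Definition vanishing_code (Q : set (index_grid r)) : set (abelian_algebra F r) :=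
  [set f | forall m, Q m -> code_eval f (power_point m) = 0].

End Evaluation.

(* Main.v *)
(* For points m, k of the grid put chi(m, k) = alpha^(m k).  These characters are
   orthogonal, so the values f(alpha^m) determine f, and a function u on the grid
   is m |-> f(alpha^m) for some f over F as soon as u(m q) = u(m)^q, because its
   Fourier coefficients are then fixed by the Frobenius.  For a union Q of q-orbits
   the indicator of the complement of Q is such a u, and it separates Q from any
   point outside Q.  If g lies in the ideal C, then 1/g (with 1/0 = 0) is also such
   a u, so C contains an element equal to 1 at any given point outside D(C);
   subtracting these from 1 and multiplying gives p in 1 + C vanishing outside
   D(C).  If f vanishes on D(C), then f p = 0, so f = f (1 - p) is in C. *)

From mathcomp Require Import fingroup pgroup abelian finfield.
Require Import Defs.
From HB Require Import structures.
From mathcomp Require Import all_boot all_algebra.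
From mathcomp Require Import boolp classical_sets functions.
From mathcomp Require Import mpoly.

Local Open Scope ring_scope.
Local Open Scope classical_set_scope.

Set Implicit Arguments.
Unset Strict Implicit.
Unset Printing Implicit Defensive.

Import GRing.Theory.

(** * Expansion of products of sums and of polynomial values *)

Lemma prod_sum_dffun (R : comNzRingType) (I : finType) (T : I -> finType)
    (E : forall i, T i -> R) :
  \prod_i \sum_(j : T i) E i j
  = \sum_(m : {dffun forall i, T i}) \prod_i E i (m i).
Proof.
pose P i := [ffun j => E i j].
transitivity (\prod_i \sum_(j : T i) P i j).
  by apply: eq_bigr => i _; apply: eq_bigr => j _; rewrite ffunE.
(* Through [fprod], the components become tagged values of one common type, to which the
   non-dependent distributive law applies. The default [0] of [untag] is never met, since each sum
   runs over tag [i] only. *)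
rewrite (reindex (@dffun_of_fprod _ T)) /=; last first.
  exact: onW_bij (dffun_of_fprod_bij T).
transitivity (\sum_(t : fprod T) \prod_i P i (t i)); last first.
  by apply: eq_bigr => t _; apply: eq_bigr => i _; rewrite !ffunE.
rewrite big_fprod.
rewrite -(bigA_distr_big_dep (fun i => tagged_with T i)
  (fun i j => untag 0 (P i) j)).
by apply: eq_bigr => i _; rewrite (big_tag (fun i => P i)).
Qed.

Lemma meval_map_mpoly (n : nat) (R S : comNzRingType) (f : {rmorphism R -> S})
    (p : {mpoly R[n]}) (x : 'I_n -> S) :
  (map_mpoly f p).@[x] = \sum_(m <- msupp p) f p@_m * \prod_i x i ^+ m i.
Proof.
pose ev := (meval x \o map_mpoly f : {rmorphism {mpoly R[n]} -> S}).
rewrite -[LHS]/(ev p) [in LHS](mpolyE p) rmorph_sum; apply: eq_bigr => m _.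
by rewrite -mul_mpolyC rmorphM /= map_mpolyC mevalC map_mpolyX mevalX.
Qed.

(** * The Frobenius power on an extension of a finite field *)

Section FiniteFieldExtension.
Variables (F : finFieldType) (L : fieldType) (iota : {rmorphism F -> L}).

(** The order of [F] is a power of its characteristic, which [iota] preserves. This makes the power
    map of exponent [#|F|] additive on [L]. *)
Lemma pchar_nat_card : [pchar L].-nat #|F|.
Proof.
have /is_abelemP [p p_pr /abelem_pgroup pF] := finField_is_abelem F.
have := pF; rewrite /pgroup cardsT => /p_natP [k cF].
have pL : p \in [pchar L].
  by rewrite (fmorph_pchar iota) (card_finPcharP cF).
by rewrite cF (eq_pnat _ (pcharf_eq pL)) pnatX pnat_id.
Qed.

Lemma expr0_card : 0 ^+ #|F| = 0 :> L.
Proof. by rewrite expr0n -leqn0 leqNgt (ltnW (finNzRing_gt1 F)). Qed.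

Lemma expf_card_sum (I : Type) (t : seq I) (P : pred I) (E : I -> L) :
  (\sum_(i <- t | P i) E i) ^+ #|F| = \sum_(i <- t | P i) E i ^+ #|F|.
Proof.
apply: (big_morph (fun x : L => x ^+ #|F|)) => [x y|].
  exact/exprDn_pchar/pchar_nat_card.
exact: expr0_card.
Qed.

(** Over [F], X^q - X is the product of all X - x, so its roots in [L] already come from [F]. *)
Lemma expf_card_fixed (y : L) : y ^+ #|F| = y -> exists x, y = iota x.
Proof.
move=> yq; have := congr1 (fun p => (map_poly iota p).[y]) (finField_genPoly F).
rewrite rmorphB /= map_polyXn map_polyX !hornerE yq subrr rmorph_prod horner_prod.
move=> /esym/eqP/prodf_eq0 [x _].
rewrite rmorphB /= map_polyX map_polyC !hornerE subr_eq0 => /eqP ->.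
by exists x.
Qed.

End FiniteFieldExtension.

(** * Characters of the grid and their orthogonality *)

Section Fourier.
Variables (L : fieldType) (s : nat) (r : 'I_s -> nat) (alpha : 'I_s -> L).
Hypothesis halpha : forall i, (r i).-primitive_root (alpha i).

Definition chi (m k : index_grid r) : L := \prod_i power_point alpha m i ^+ k i.

Lemma chiC m k : chi m k = chi k m.
Proof. by apply: eq_bigr => i _; rewrite /power_point exprAC. Qed.

Lemma alpha_neq0 i : alpha i != 0.
Proof.
apply/eqP => a0; have /eqP := prim_expr_order (halpha i).
by rewrite a0 expr0n eqn0Ngt (prim_order_gt0 (halpha i)) eq_sym oner_eq0.
Qed.

(** A geometric sum: for k != l the ratio z differs from 1 while z^(r i) = 1, so z^(r i) - 1 = (z -
    1) * sum forces the sum to vanish. *)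
Lemma sum_prim_root_expr i (k l : 'I_(r i)) :
  \sum_(j < r i) (alpha i ^+ k / alpha i ^+ l) ^+ j = (r i)%:R *+ (k == l).
Proof.
have [->|nkl] := eqVneq k l.
  rewrite divff ?expf_neq0 ?alpha_neq0 //.
  by under eq_bigr do rewrite expr1n; rewrite sumr_const card_ord.
set z := _ / _.
have z1 : z != 1.
  apply: contra nkl => /eqP/divr1_eq/eqP.
  by rewrite (eq_prim_root_expr (halpha i)) !modn_small.
have /eqP := subrX1 z (r i).
rewrite /z expr_div_n ![_ ^+ _ ^+ r i]exprAC (prim_expr_order (halpha i)).
rewrite !expr1n divr1 subrr eq_sym mulf_eq0 subr_eq0 (negPf z1) /=.
by move/eqP.
Qed.

(** The sum factors over the coordinates, and one coordinate where [m] and [l] differ contributes a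
    factor 0. *)
Lemma chi_orthogonal m l :
  \sum_k chi m k / chi l k = (\prod_i r i)%:R *+ (m == l).
Proof.
transitivity (\prod_i \sum_(j < r i) (alpha i ^+ m i / alpha i ^+ l i) ^+ j).
  rewrite prod_sum_dffun; apply: eq_bigr => k _.
  by rewrite -prodf_div; apply: eq_bigr => i _; rewrite expr_div_n.
under eq_bigr do rewrite sum_prim_root_expr.
have [->|nml] := eqVneq m l.
  by rewrite natr_prod; apply: eq_bigr => i _; rewrite eqxx.
have [i ni] : exists i, m i != l i.
  apply/existsP; apply: contraR nml; rewrite negb_exists => /forallP eml.
  by apply/eqP/ffunP => i; apply/eqP; have := eml i; rewrite negbK.
by rewrite (bigD1 i) //= (negPf ni) mul0r.
Qed.

Lemma card_grid_neq0 : (\prod_i r i)%:R != 0 :> L.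
Proof.
rewrite natr_prod; apply/prodf_neq0 => i _.
exact: prim_root_natf_neq0 (halpha i).
Qed.

End Fourier.

(** * Multiplication by q on the grid and its orbits *)

Section Codes.
Variables (F : finFieldType) (L : fieldType) (iota : {rmorphism F -> L}).
Variables (s : nat) (r : 'I_s -> nat) (alpha : 'I_s -> L).
Hypothesis halpha : forall i, (r i).-primitive_root (alpha i).
Hypothesis hqr : forall i, coprime #|F| (r i).

Local Notation A := (abelian_algebra F r).
Local Notation grid := (index_grid r).
Local Notation q := #|F|.
Local Notation ev m f := (@code_eval F L iota s r f (@power_point L s r alpha m)).
Local Notation piA := (\pi_A%qT : {rmorphism {mpoly F[s]} -> A}).

Let r_gt0 i : (0 < r i)%N := prim_order_gt0 (halpha i).

(** Arbitrary exponents are accepted, so that both the multiples [m i * q] and the exponents of a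
    monomial can be reduced. *)
Definition reduce_index (k : 'I_s -> nat) : grid :=
  [ffun i => Ordinal (ltn_pmod (k i) (r_gt0 i))].

Definition mulq (m : grid) : grid := reduce_index (fun i => m i * q)%N.

Lemma iter_mulqE j (m : grid) i :
  iter j mulq m i = ((m i * q ^ j) %% r i)%N :> nat.
Proof.
elim: j => [|j IHj] /=; first by rewrite expn0 muln1 modn_small.
by rewrite ffunE /= IHj modnMml -mulnA expnSr.
Qed.

Lemma mulq_inj : injective mulq.
Proof.
(* Cancellation of q, which is prime to [r i]. The order on [a] and [b] keeps the natural
   subtraction exact; the other order follows by symmetry. *)
have inj i a b : (a <= b)%N -> (a * q = b * q %[mod r i])%N ->
    a = b %[mod r i].
  move=> le_ab /esym/eqP; rewrite eqn_mod_dvd ?leq_mul2r ?le_ab ?orbT //.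
  rewrite -mulnBl Gauss_dvdl 1?coprime_sym //.
  by rewrite -eqn_mod_dvd // => /eqP.
move=> m k emk; apply/ffunP => i; apply: val_inj => /=.
rewrite -[LHS](modn_small (ltn_ord _)) -[RHS](modn_small (ltn_ord _)).
have := congr1 (fun g : grid => val (g i)) emk; rewrite !ffunE /= => e.
by have [/inj|/ltnW/inj/(_ (esym e))] := leqP (m i) (k i); [exact|].
Qed.

Lemma qorbitP (a b : grid) : qorbit q a b <-> exists j, b = iter j mulq a.
Proof.
split=> [[j eb]|[j ->]]; exists j; last exact: iter_mulqE.
by apply/ffunP => i; apply: val_inj; rewrite /= eb iter_mulqE.
Qed.

Lemma qorbit_unionsP (Q : set grid) :
  qorbit_unions q Q <-> forall m, Q (mulq m) <-> Q m.
Proof.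
split=> [[B ->] m|QE].
  split=> -[a Ba /qorbitP [j ej]]; exists a => //; apply/qorbitP.
    (* As [mulq] is injective on a finite set, [m] lies on a cycle: one step is undone by going
       round the rest of it. *)
    exists ((order mulq m).-1 + j)%N; rewrite iterD -ej -iterSr.
    by rewrite (prednK (order_gt0 _ _)) (iter_order mulq_inj).
  by exists j.+1; rewrite ej.
exists Q; apply/seteqP; split=> [m Qm|m [a Qa /qorbitP [j ->]]].
  by exists m => //; apply/qorbitP; exists 0%N.
by elim: j => //= j IHj; apply/QE.
Qed.

Lemma power_point_mulq m i :
  power_point alpha (mulq m) i = power_point alpha m i ^+ q.
Proof.
rewrite /power_point ffunE /= expr_mod ?exprM //.
exact: prim_expr_order (halpha i).
Qed.

Lemma chi_mulq m k : chi alpha (mulq m) k = chi alpha m k ^+ q.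
Proof.
rewrite -prodrXl; apply: eq_bigr => i _.
by rewrite power_point_mulq exprAC.
Qed.

(** * Evaluation on the quotient algebra and Fourier inversion *)

Lemma eval_pi (p : {mpoly F[s]}) (m : grid) :
  ev m (piA p) = (map_mpoly iota p).@[power_point alpha m].
Proof. exact: code_eval_power_point. Qed.

Lemma evalB (m : grid) f g : ev m (f - g : A) = ev m f - ev m g.
Proof. by rewrite -(reprK f) -(reprK g) -(rmorphB piA) !eval_pi !rmorphB. Qed.

Lemma evalD (m : grid) f g : ev m (f + g : A) = ev m f + ev m g.
Proof. by rewrite -(reprK f) -(reprK g) -(rmorphD piA) !eval_pi !rmorphD. Qed.

Lemma evalM (m : grid) f g : ev m (f * g : A) = ev m f * ev m g.
Proof. by rewrite -(reprK f) -(reprK g) -(rmorphM piA) !eval_pi !rmorphM. Qed.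

Lemma eval0 (m : grid) : ev m (0 : A) = 0.
Proof. by rewrite -(rmorph0 piA) eval_pi !rmorph0. Qed.

Lemma eval1 (m : grid) : ev m (1 : A) = 1.
Proof. by rewrite -(rmorph1 piA) eval_pi !rmorph1. Qed.

(** The q-th power is additive and fixes the coefficients, which lie in [F]; only the point
    moves. *)
Lemma eval_mulq (m : grid) f : ev (mulq m) f = ev m f ^+ q.
Proof.
rewrite /code_eval !meval_map_mpoly (expf_card_sum iota); apply: eq_bigr => k _.
rewrite exprMn -rmorphXn expf_card -prodrXl; congr (_ * _).
by apply: eq_bigr => i _; rewrite power_point_mulq exprAC.
Qed.

Definition grid_poly (c : grid -> F) : A :=
  piA (\sum_(k : grid) c k *: \prod_i 'X_i ^+ k i).

Lemma eval_grid_poly c m :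
  ev m (grid_poly c) = \sum_k iota (c k) * chi alpha m k.
Proof.
pose ev := (meval (power_point alpha m) \o map_mpoly iota
            : {rmorphism {mpoly F[s]} -> L}).
rewrite eval_pi -[LHS]/(ev _) rmorph_sum; apply: eq_bigr => k _.
rewrite -mul_mpolyC rmorphM rmorph_prod /= map_mpolyC mevalC.
congr (_ * _); apply: eq_bigr => i _.
by rewrite !rmorphXn /= map_mpolyX mevalXU.
Qed.

Lemma pi_X_expr i : piA 'X_i ^+ r i = 1.
Proof.
rewrite -rmorphXn -(rmorph1 piA); apply/eqP.
rewrite -Quotient.idealrBE; apply/asboolP; exists (fun j => (j == i)%:R).
rewrite (bigD1 i) //= eqxx mul1r big1 ?addr0 // => j /negPf ->.
by rewrite mul0r.
Qed.

(** Since X_i^(r i) = 1 in the quotient, monomials with the same reduced exponents coincide, and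
    their coefficients are added up. *)
Lemma grid_poly_surj f : exists c, f = grid_poly c.
Proof.
pose p := repr f.
exists (fun k => \sum_(m <- msupp p | reduce_index m == k) p@_m).
rewrite -[LHS]reprK -/p [in LHS](mpolyE p) /grid_poly.
rewrite [LHS](rmorph_sum piA).
rewrite (partition_big (fun m : 'X_{1..s} => reduce_index m) xpredT) //=.
rewrite [RHS](rmorph_sum piA); apply: eq_bigr => k _.
rewrite scaler_suml [RHS](rmorph_sum piA); apply: eq_bigr => m /eqP <-.
rewrite -!mul_mpolyC !rmorphM /= mpolyXE_id; congr (_ * _).
rewrite !rmorph_prod; apply: eq_bigr => i _.
by rewrite !rmorphXn ffunE /= (expr_mod _ (pi_X_expr i)).
Qed.

Lemma eval_eq0 f : (forall m, ev m f = 0) -> f = 0.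
Proof.
have [c ->] := grid_poly_surj f => f0.
suff c0 l : c l = 0.
  rewrite /grid_poly big1 ?rmorph0 // => k _; by rewrite c0 scale0r.
apply/eqP; rewrite -(fmorph_eq0 iota).
suff /eqP : iota (c l) * (\prod_i r i)%:R = 0.
  by rewrite mulf_eq0 (negPf (card_grid_neq0 halpha)) orbF.
(* Fourier inversion: orthogonality isolates the coefficient at [l]. *)
have <- : \sum_(m : grid) ev m (grid_poly c) / chi alpha m l
    = iota (c l) * (\prod_i r i)%:R.
  under [LHS]eq_bigr do rewrite eval_grid_poly mulr_suml.
  rewrite exchange_big (bigD1 l) //= [X in _ + X]big1 => [|k nkl].
    under [X in X + _]eq_bigr do rewrite -mulrA ![chi _ _ l]chiC.
    by rewrite -mulr_sumr chi_orthogonal // eqxx addr0.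
  under eq_bigr do rewrite -mulrA [chi _ _ l]chiC [chi _ _ k]chiC.
  by rewrite -mulr_sumr chi_orthogonal // (negPf nkl) mulr0.
by apply: big1 => m _; rewrite f0 mul0r.
Qed.

Lemma eval_interpolation (u : grid -> L) :
  (forall m, u (mulq m) = u m ^+ q) -> exists f : A, forall m, ev m f = u m.
Proof.
move=> uq; pose n : L := (\prod_i r i)%:R.
have n0 : n != 0 by exact: card_grid_neq0 halpha.
(* The q-th power fixes n, an image of a natural number, and sends the term at [m] to the term at
   [mulq m], so it merely permutes the sum. *)
have cP k : exists x, n^-1 * \sum_m u m / chi alpha m k = iota x.
  apply: expf_card_fixed.
  rewrite exprMn (expf_card_sum iota) exprVn.
  congr (_^-1 * _).
    by rewrite /n -(rmorph_nat iota) -rmorphXn expf_card.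
  rewrite [RHS](reindex_inj mulq_inj); apply: eq_bigr => m _.
  by rewrite uq chi_mulq expr_div_n.
have [c cE] := fin_all_exists cP.
exists (grid_poly c) => l; rewrite eval_grid_poly.
under eq_bigr do rewrite -cE -mulrA mulr_suml.
rewrite -mulr_sumr exchange_big (bigD1 l) //= [X in _ + X]big1 => [|m nml].
  under eq_bigr do rewrite mulrAC -mulrA.
  by rewrite -mulr_sumr chi_orthogonal // eqxx addr0 mulrCA mulVf // mulr1.
under eq_bigr do rewrite mulrAC -mulrA.
by rewrite -mulr_sumr chi_orthogonal // eq_sym (negPf nml) mulr0.
Qed.

(** * The two maps between ideals and unions of orbits *)

Lemma defining_set_qorbit_unions (C : set A) :
  qorbit_unions q (defining_set iota alpha C).
Proof.
apply/qorbit_unionsP => m; split=> Dm f /Dm; rewrite eval_mulq.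
  by move/eqP; rewrite expf_eq0 => /andP [_ /eqP].
by move=> ->; rewrite expr0_card.
Qed.

Lemma vanishing_code_ideal (Q : set grid) :
  abelian_codes (vanishing_code iota alpha Q).
Proof.
split=> [m _|f g f0 g0 m Qm|f g g0 m Qm]; first exact: eval0.
  by rewrite evalD f0 // g0 // addr0.
by rewrite evalM g0 // mulr0.
Qed.

Lemma ideal_unit_at (C : set A) (m : grid) : is_ideal C ->
  ~ defining_set iota alpha C m -> exists2 e, C e & ev m e = 1.
Proof.
move=> [_ _ CM] /existsNP [g /not_implyP [Cg gm]].
(* Inversion commutes with powers even at 0, thanks to 0^-1 = 0, so zeros of [g] cause no
   exception. *)
have [g' g'E] : exists g' : A, forall k : grid, ev k g' = (ev k g)^-1.
  by apply: eval_interpolation => k; rewrite eval_mulq exprVn.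
exists (g' * g); first exact: CM.
by rewrite evalM g'E mulVf //; apply/eqP.
Qed.

Lemma defining_setK (C : set A) : is_ideal C ->
  vanishing_code iota alpha (defining_set iota alpha C) = C.
Proof.
move=> idC; apply/seteqP; split=> [f f0|f Cf m]; last exact.
have [C0 CD CM] := idC.
(* Taking [e = 0] on the defining set gives a factor 1 there, so the product [p] can run over the
   whole grid. *)
have eP (m : grid) : exists e : A,
    C e /\ (~ defining_set iota alpha C m -> ev m e = 1).
  case: (EM (defining_set iota alpha C m)) => [Dm|/(ideal_unit_at idC) [e Ce e1]].
    by exists 0.
  by exists e.
have [e eE] := fin_all_exists eP.
pose p := \prod_m (1 - e m).
have Cp : C (1 - p).
  rewrite /p; apply: (big_ind (fun x => C (1 - x))) => [|x y Cx Cy|m _].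
  - by rewrite subrr.
  - have -> : 1 - x * y = y * (1 - x) + (1 - y).
      by rewrite mulrBr mulr1 [RHS]addrC addrA subrK mulrC.
    exact: CD (CM _ _ _) _.
  - by rewrite subKr; case: (eE m).
suff fp : f * p = 0.
  by rewrite -[f]mulr1 -(subrK p 1) mulrDr fp addr0; apply: CM.
apply: eval_eq0 => m; rewrite evalM.
case: (EM (defining_set iota alpha C m)) => [/f0 -> |nDm]; first by rewrite mul0r.
rewrite /p (bigD1 m) //= evalM evalB eval1 (eE m).2 //.
by rewrite subrr mul0r mulr0.
Qed.

Lemma vanishing_codeK (Q : set grid) : qorbit_unions q Q ->
  defining_set iota alpha (vanishing_code iota alpha Q) = Q.
Proof.
move=> /qorbit_unionsP QE; apply/seteqP; split=> [m Dm|m Qm f]; last exact.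
(* The values 0 and 1 are their own q-th powers, so the interpolation condition reduces to the
   invariance of [Q] under [mulq]. *)
have [f fE] : exists f : A, forall k : grid, ev k f = (~~ `[< Q k >])%:R.
  apply: eval_interpolation => k; rewrite (asbool_equiv_eq (QE k)).
  by case: asbool; rewrite ?expr1n ?expr0_card.
apply: contrapT => nQm.
have /Dm /eqP : vanishing_code iota alpha Q f by move=> k Qk; rewrite fE asboolT.
by rewrite fE asboolF // oner_eq0.
Qed.

End Codes.

Theorem theorem14 (F : finFieldType) (q : nat) (hq : #|F| = q)
    (s : nat) (r : 'I_s -> nat) (hr : forall i, (0 < r i)%N)
    (n : nat) (hn : n = (\prod_(i < s) r i)%N) (hnq : coprime n q)
    (L : fieldType) (iota : {rmorphism F -> L})
    (alpha : 'I_s -> L) (halpha : forall i, (r i).-primitive_root (alpha i)) :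
  [/\ set_bij (@abelian_codes F s r) (@qorbit_unions s r q)
        (@defining_set F L iota s r alpha),
      set_bij (@qorbit_unions s r q) (@abelian_codes F s r)
        (@vanishing_code F L iota s r alpha),
      forall C : set (abelian_algebra F r), abelian_codes C ->
        vanishing_code iota alpha (defining_set iota alpha C) = C
    & forall Q : set (index_grid r), qorbit_unions q Q ->
        defining_set iota alpha (vanishing_code iota alpha Q) = Q].
Proof.
subst q.
have hqr i : coprime #|F| (r i).
  rewrite coprime_sym; apply: coprime_dvdl hnq.
  by rewrite hn (bigD1 i) //= dvdn_mulr.
have VD := defining_setK iota halpha hqr.
have DV := vanishing_codeK iota halpha hqr.
have DQ := defining_set_qorbit_unions iota halpha hqr.
have VI := vanishing_code_ideal iota halpha.
(* Each map is injective and surjective because the other is its two-sided inverse. *)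
split=> //; split=> [x _|x y|x cx].
- exact: DQ.
- by rewrite !inE => /VD {2}<- /VD {2}<- ->.
- by exists (vanishing_code iota alpha x); [exact: VI|exact: DV].
- exact: VI.
- by rewrite !inE => /DV {2}<- /DV {2}<- ->.
- by exists (defining_set iota alpha x); [exact: DQ|exact: VD].
Qed.
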